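(* Let $e>r\ge 3$ and $w\ge 0$ be integers. In $\mathcal{W}_{r,e,w}(1^r)$, each copy of $\mathcal{W}_{r,e}(1^r)$ (corresponding to an $r$-partition of $w$ of type $(1^r)$, equivalently to a weak composition of $w$ of length $r$) is exactly the set of dominant weights in the interior of some dominant $e$-alcove. That is, for every weak composition $\mu=(\mu_1,\dots,\mu_r)$ of $w$ there is a dominant $e$-alcove $\mathcal{A}$ with $S_\mu=\mathcal{A}\cap P^+$.
   Context: Abaci. A partition $\lambda$ with at most $r$ parts (padded by zeros) has $r$-beta numbers $\beta_t=\lambda_t+r-t$ for $1\le t\le r$; these are strictly decreasing non-negative integers determining $\lambda$. Its $e$-abacus with $r$ beads has runners $0,\dots,e-1$ and rows $0,1,2,\dots$, with the bead $\beta_t=ae+b$, $0\le b\le e-1$, placed in row $a$ of runner $b$. Weights. Let $P=\bigoplus_{t=1}^{r-1}\mathbb{Z}\Lambda_t$ be the weight lattice of $\mathfrak{sl}_r$, $P^+=\bigoplus_t\mathbb{Z}_{\ge 0}\Lambda_t$ the dominant weights, and $\Omega(\lambda)=\sum_{t=1}^{r-1}(\beta_t-\beta_{t+1})\Lambda_t$. Copies. A weak composition of $w$ of length $r$ is a sequence $\mu=(\mu_1,\dots,\mu_r)$ of non-negative integers with sum $w$; it is identified with the $r$-tuple of partitions $((\mu_1),\dots,(\mu_r))$ (with $(0)=\emptyset$), which is an $r$-partition of $w$ of type $(1^r)$, i.e. with all components of length at most $1$. $\mathcal{W}_{r,e,w}(1^r)$ is the set of all $\Omega(\lambda)$ for which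 the $e$-abacus of $\lambda$ with $r$ beads has at most one bead on each runner and the sum of the row indices of the beads is $w$; also $\mathcal{W}_{r,e}(1^r)=\mathcal{W}_{r,e,0}(1^r)$. The copy of $\mathcal{W}_{r,e}(1^r)$ in $\mathcal{W}_{r,e,w}(1^r)$ corresponding to $\mu$ is the set $S_\mu$ of all $\Omega(\lambda)$ such that the $e$-abacus of $\lambda$ with $r$ beads has exactly one bead on each of $r$ runners $s_1<\cdots<s_r$ (any choice of such runners), the bead on runner $s_t$ being in row $\mu_t$. Alcoves. Let $E=\{x\in\mathbb{R}^r:\sum x_t=0\}=P\otimes\mathbb{R}$, with simple roots $\alpha_t=\varepsilon_t-\varepsilon_{t+1}$, positive roots $R^+=\{\varepsilon_s-\varepsilon_t:s<t\}$, $\alpha^\vee=\alpha$, $\langle\alpha_s^\vee,\Lambda_t\rangle=\delta_{st}$. The $e$-alcoves are the connected components of the complement in $E$ of all hyperplanes $\{x:\langle\alpha^\vee,x\rangle=ke\}$, $\alpha\in R^+$, $k\in\mathbb{Z}$ (so they are open). An $e$-alcove is dominant if it is contained in $\{x:\langle\alpha_t^\vee,x\rangle\ge 0\ \forall t\}$. *)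

(* Defs.v *)
From HB Require Import structures.
From mathcomp Require Import all_boot all_order all_algebra.
From mathcomp Require Import all_classical all_reals all_analysis.
Set Implicit Arguments.
Unset Strict Implicit.
Unset Printing Implicit Defensive.
Import Order.TTheory GRing.Theory Num.Theory.
Import numFieldNormedType.Exports.
Local Open Scope classical_set_scope.
Local Open Scope ring_scope.

(** Tuples and row vectors are indexed by ['I_r], i.e. from 0, whereas the
    beta numbers and the fundamental weights keep their usual indices, which
    start from 1. *)

(** A partition with at most [r] parts is its zero-padded [r]-tuple of parts. *)
Definition is_partition (r : nat) (lam : r.-tuple nat) : Prop := sorted geq lam.

(** beta_t for 1 <= t <= r. *)
Definition beta (r : nat) (lam : r.-tuple nat) (t : nat) : nat :=
  (nth 0 lam t.-1 + (r - t))%N.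

Definition bead (r e : nat) (lam : r.-tuple nat) (row : nat) (runner : 'I_e) :
    bool :=
  [exists t : 'I_r, beta lam t.+1 == row * e + runner]%N.

Definition weak_composition (r w : nat) (mu : r.-tuple nat) : Prop :=
  (\sum_(t < r) tnth mu t = w)%N.

Section Weights.
Variables (R : realType) (r : nat).
Implicit Types (x y : 'rV[R]_r) (A : set 'rV[R]_r).

Definition Espace : set 'rV[R]_r := [set x | \sum_(j < r) x 0 j = 0].

Definition pairing x y : R := \sum_(j < r) x 0 j * y 0 j.

(** epsilon_i - epsilon_j, which is its own coroot; positive iff i < j and
    simple iff j = i + 1. *)
Definition root_vec (i j : 'I_r) : 'rV[R]_r := delta_mx 0 i - delta_mx 0 j.

(** Lambda_t for 1 <= t < r: the projection of
    epsilon_1 + ... + epsilon_t to [Espace]. *)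
Definition fund_weight (t : nat) : 'rV[R]_r :=
  \row_(j < r) ((j < t)%:R - t%:R / r%:R).

Lemma pairing_root (i j : 'I_r) x : pairing (root_vec i j) x = x 0 i - x 0 j.
Proof.
rewrite /pairing /root_vec.
under eq_bigr do rewrite !mxE mulrBl !eqxx /=.
rewrite sumrB; congr (_ - _).
  rewrite (bigD1 i) //= eqxx mul1r big1 ?addr0 // => k /negPf->.
  by rewrite mul0r.
rewrite (bigD1 j) //= eqxx mul1r big1 ?addr0 // => k /negPf->.
by rewrite mul0r.
Qed.

Lemma fund_weight_Espace (t : nat) : (0 < t < r)%N -> Espace (fund_weight t).
Proof.
move=> /andP[t0 tr]; rewrite /Espace /=.
under eq_bigr do rewrite mxE.
rewrite sumrB sumr_const card_ord -[_ *+ r]mulr_natr divfK; last first.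
  by rewrite pnatr_eq0 -lt0n (ltn_trans t0).
rewrite -natr_sum -big_mkcond /= sum1_card.
have -> : #|[pred i : 'I_r | (i < t)%N]| = t.
  rewrite -sum1_card (eq_bigl (fun i : 'I_r => (i < t)%N)) //.
  by rewrite -(big_ord_widen r (fun=> 1%N) (ltnW tr)) sum1_card card_ord.
exact: subrr.
Qed.

Lemma pairing_simple_fund_weight (i j : 'I_r) (t : nat) : j = i.+1 :> nat ->
  pairing (root_vec i j) (fund_weight t) = (i.+1 == t)%:R.
Proof.
move=> ji; rewrite pairing_root !mxE ji.
by case: (ltngtP i.+1 t) => [it|it|<-];
  rewrite ?ltnn ?ltnSn ?(ltnW it) ?(ltnNge i t) -?ltnS ?it /= ?subrr ?addrKA;
  rewrite ?opprB ?addrA ?addrK ?subrr ?subr0 // ?addrNK ?subrr.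
Qed.

Definition dominant_weights : set 'rV[R]_r :=
  [set x | exists c : nat -> nat,
     x = \sum_(1 <= t < r) (c t)%:R *: fund_weight t].

Definition Omega (lam : r.-tuple nat) : 'rV[R]_r :=
  \sum_(1 <= t < r) ((beta lam t)%:R - (beta lam t.+1)%:R) *: fund_weight t.

(** The set S_mu, i.e. the copy of W_{r,e}(1^r) corresponding to [mu]; the
    [r] beads on the runners [s t] are all the beads of the abacus. *)
Definition copy (e : nat) (mu : r.-tuple nat) : set 'rV[R]_r :=
  [set x | exists (lam : r.-tuple nat) (s : 'I_r -> 'I_e),
     [/\ is_partition lam,
         (forall t u : 'I_r, (t < u)%N -> (s t < s u)%N),
         (forall (t : 'I_r) (a : nat), bead lam a (s t) <-> a = tnth mu t) &
         x = Omega lam]].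

Definition hyperplane (e : nat) (i j : 'I_r) (k : int) : set 'rV[R]_r :=
  [set x | pairing (root_vec i j) x = k%:~R * e%:R].

Definition hyperplane_complement (e : nat) : set 'rV[R]_r :=
  [set x | Espace x /\
     forall (i j : 'I_r) (k : int), (i < j)%N -> ~ hyperplane e i j k x].

Definition is_alcove (e : nat) A : Prop :=
  exists2 x, hyperplane_complement e x &
    A = connected_component (hyperplane_complement e) x.

Definition dominant_chamber : set 'rV[R]_r :=
  [set x | Espace x /\
     forall i j : 'I_r, j = i.+1 :> nat -> 0 <= pairing (root_vec i j) x].

Definition is_dominant_alcove (e : nat) A : Prop :=
  is_alcove e A /\ A `<=` dominant_chamber.

End Weights.
Arguments dominant_weights : clear implicits.
Arguments copy R {r} e mu.

(* Main.v *)
(** The bead of runner [s t] is [mu_t e + s t], so the decreasing order of the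
    beads is the lexicographic one on [(mu_t, t)]: a single permutation [p]
    sorts the beads of every configuration in the copy, bead [t] being the
    [p t]-th largest. The point [x = Omega lam] thus satisfies
    [x (p t) - mu_t e = s t + constant], and the conditions
    [0 <= s 0 < s 1 < ... < e] become
    [0 < (x (p u) - mu_u e) - (x (p t) - mu_t e) < e] for [t < u]. For every
    positive root these confine its pairing with [x] to one interval
    [(k e, (k + 1) e)], with [k >= 0]. Such a region is convex, hence connected,
    and any connected set avoiding the hyperplanes that meets it stays in it, by
    the intermediate value theorem applied to each root. Conversely the
    inequalities allow one to recover [s] from a dominant weight, normalised by
    [s 0 = 0]. *)

Require Import Defs.
From HB Require Import structures.
From mathcomp Require Import all_boot all_order all_algebra all_fingroup.
From mathcomp Require Import all_classical all_reals all_analysis.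
From mathcomp Require Import zify ring lra.
Import Order.TTheory GRing.Theory Num.Theory.
Import numFieldNormedType.Exports.
Local Open Scope ring_scope.

(** * Ranks and sorting permutations of a finite ordinal *)

Lemma card_ord_lt (r k : nat) : (k <= r)%N -> #|[set i : 'I_r | (i < k)%N]| = k.
Proof.
move=> kr; rewrite -sum1_card.
under eq_bigl do rewrite inE.
by rewrite -(big_ord_widen r (fun=> 1%N) kr) sum1_card card_ord.
Qed.

Lemma ord_rank (r : nat) (f : 'I_r -> 'I_r) (t : 'I_r) : injective f ->
  #|[set u | (f u < f t)%N]| = f t.
Proof.
move=> fI; rewrite -[RHS](card_ord_lt _ _ (ltnW (ltn_ord (f t)))).
rewrite -[RHS](card_preimset _ fI).
by apply: eq_card => u; rewrite !inE.
Qed.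

(** Each value of an injective self-map of ['I_r] is the number of arguments with a smaller value,
    so the order pattern determines the map. *)
Lemma ord_inj_lt_unique (r : nat) (f g : 'I_r -> 'I_r) :
  injective f -> injective g ->
  (forall t u, (f t < f u)%N = (g t < g u)%N) -> f =1 g.
Proof.
move=> fI gI fg t; apply: val_inj; rewrite /= -(ord_rank _ _ _ fI).
by rewrite -(ord_rank _ _ _ gI); apply: eq_card => u; rewrite !inE fg.
Qed.

Lemma ord_homo_mono (r : nat) (f : 'I_r -> nat) :
  (forall t u : 'I_r, (t < u)%N -> (f t < f u)%N) ->
  forall t u : 'I_r, (f t < f u)%N = (t < u)%N.
Proof.
move=> fI t u; case: (ltngtP t u) => [/fI//|/fI|/val_inj ->].
  by move=> /ltnW; rewrite leqNgt => /negPf.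
by rewrite ltnn.
Qed.

Lemma exists_sorting_perm (r : nat) (f : 'I_r -> nat) : injective f ->
  exists p : {perm 'I_r}, forall t u, (p t < p u)%N = (f u < f t)%N.
Proof.
move=> fI.
have rank_lt t : (#|[set u | (f t < f u)%N]| < r)%N.
  rewrite -[X in (_ < X)%N]card_ord -cardsT; apply: proper_card.
  apply/properP; split; first by apply/fintype.subsetP => u; rewrite inE.
  by exists t; rewrite !inE ?ltnn.
(* The position of [t] is the number of [u] with a larger value of [f]. *)
pose q t := Ordinal (rank_lt t).
have qlt t u : (f u < f t)%N -> (q t < q u)%N.
  move=> ut; apply: proper_card; apply/properP; split.
    by apply/fintype.subsetP => v; rewrite !inE; exact: ltn_trans.
  by exists t; rewrite !inE ?ltnn.
have qlt_eq t u : (q t < q u)%N = (f u < f t)%N.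
  apply/idP/idP; last exact: qlt.
  case: (ltngtP (f u) (f t)) => // [/qlt|/fI ->]; last by rewrite ltnn.
  by move=> /ltnW; rewrite leqNgt => /negPf ->.
have qI : injective q.
  move=> t u qtu; apply: fI.
  by case: (ltngtP (f t) (f u)); rewrite // -qlt_eq qtu ltnn.
by exists (perm qI) => t u; rewrite !permE.
Qed.

Lemma ltn_mulD_lex (e m n a b : nat) : (a < e)%N -> (b < e)%N ->
  (m * e + a < n * e + b)%N = ((m < n) || (m == n) && (a < b))%N.
Proof.
move=> ae be; case: (ltngtP m n) => [mn|nm|->] /=.
- have : (m.+1 * e <= n * e)%N by rewrite leq_mul2r mn orbT.
  by rewrite mulSn; lia.
- have : (n.+1 * e <= m * e)%N by rewrite leq_mul2r nm orbT.
  by rewrite mulSn; lia.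
- by rewrite ltn_add2l.
Qed.

(** * Partitions and strictly decreasing beta numbers *)

Section BetaNumbers.
Context {r : nat}.

Lemma beta_decreasing (lam : r.-tuple nat) (i j : 'I_r) : is_partition lam ->
  (i < j)%N -> (beta lam j.+1 < beta lam i.+1)%N.
Proof.
move=> lamP ij; rewrite /beta /=.
have : (nth 0 lam j <= nth 0 lam i)%N.
  apply: (sorted_ltn_nth _ _ lamP) => //; rewrite ?inE ?size_tuple //.
  by move=> a b c /= ba cb; exact: leq_trans cb ba.
have := ltn_ord j; lia.
Qed.

Lemma partition_of_beta (b : 'I_r -> nat) :
  (forall i j : 'I_r, (i < j)%N -> (b j < b i)%N) ->
  exists2 lam : r.-tuple nat, is_partition lam &
    forall i : 'I_r, beta lam i.+1 = b i.
Proof.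
move=> bD.
(* There are [r - i.+1] strictly smaller naturals after [b i]; this bound makes the truncated
   subtraction in [lam] exact. *)
have b_ge (i : 'I_r) : (r - i.+1 <= b i)%N.
  move: {2}(r - i.+1)%N (erefl (r - i.+1)%N) => n.
  elim: n i => [|n IH] i ni; first by rewrite ni.
  have ir : (i.+1 < r)%N by lia.
  have := IH (Ordinal ir); have := bD i (Ordinal ir); rewrite /=; lia.
pose lam := [tuple (b i - (r - i.+1))%N | i < r].
have lamE (i : 'I_r) : nth 0 lam i = (b i - (r - i.+1))%N.
  by rewrite -tnth_nth tnth_mktuple.
exists lam => [|i]; last by rewrite /beta [in LHS]lamE subnK.
apply/(sortedP 0%N) => i; rewrite size_tuple => ir.
have := lamE (Ordinal ir); have := lamE (Ordinal (ltnW ir)).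
have := bD (Ordinal (ltnW ir)) (Ordinal ir); rewrite /= => + -> ->; lia.
Qed.

End BetaNumbers.

Lemma convex_comb_gt (R : realFieldType) (c l a b : R) :
  0 <= c -> c <= 1 -> l < a -> l < b -> l < c * a + (1 - c) * b.
Proof.
move=> c0 c1 la lb; have [ab|/ltW ba] := leP a b.
- have : 0 <= (1 - c) * (b - a) by rewrite mulr_ge0 ?subr_ge0.
  lra.
- have : 0 <= c * (a - b) by rewrite mulr_ge0 ?subr_ge0.
  lra.
Qed.

Lemma convex_comb_lt (R : realFieldType) (c u a b : R) :
  0 <= c -> c <= 1 -> a < u -> b < u -> c * a + (1 - c) * b < u.
Proof.
move=> c0 c1 au bu; have := @convex_comb_gt R c (- u) (- a) (- b) c0 c1.
by rewrite !ltrN2 !mulrN -opprD ltrN2; apply.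
Qed.

Local Open Scope classical_set_scope.

(** * Coordinates of weights, up to a common constant *)

Section Weights.
Context {R : realType} {r : nat}.
Implicit Types (x y : 'rV[R]_r) (d : nat -> R).

(** Common form of [Omega lam], where [d] is [beta lam], and of dominant weights, where [d] is
    natural-valued. *)
Definition weight_of_gaps d : 'rV[R]_r :=
  \sum_(1 <= t < r) (d t - d t.+1) *: fund_weight R r t.

Lemma Espace_weight_of_gaps d : Espace (weight_of_gaps d).
Proof.
rewrite /Espace /weight_of_gaps /=.
under eq_bigr do rewrite summxE.
rewrite exchange_big /= big_nat_cond big1 // => t /andP[t_bnd _].
under eq_bigr do rewrite mxE.
by rewrite -mulr_sumr (fund_weight_Espace _ t_bnd) mulr0.
Qed.

(** For [i <= j], the weight [Lambda_t] separates the two coordinates only when [i < t <= j], and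
    the remaining sum telescopes. *)
Lemma weight_of_gapsB d (i j : 'I_r) :
  weight_of_gaps d 0 i - weight_of_gaps d 0 j = d i.+1 - d j.+1.
Proof.
wlog ij : i j / (i <= j)%N => [hw|].
  have [/hw//|/ltnW /hw ji] := leqP i j.
  by rewrite -opprB ji opprB.
rewrite /weight_of_gaps !summxE -sumrB.
have jr := ltn_ord j.
rewrite (@big_cat_nat _ _ _ i.+1) //=.
rewrite (@big_cat_nat _ _ _ j.+1 i.+1) //=.
rewrite [X in X + _]big_nat_cond [X in X + _]big1 ?add0r; last first.
  move=> t /andP[/andP[_ ti] _]; rewrite !mxE.
  by rewrite !ltnNge (_ : t <= i)%N // (_ : t <= j)%N ?subrr //; lia.
rewrite [X in _ + X]big_nat_cond [X in _ + X]big1 ?addr0; last first.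
  move=> t /andP[/andP[jt _] _]; rewrite !mxE.
  by rewrite jt (_ : i < t)%N ?subrr //; lia.
rewrite (eq_big_nat _ _ (F2 := fun t => - (d t.+1 - d t))); last first.
  move=> t /andP[it tj]; rewrite !mxE it ltnNge (_ : t <= j)%N //=; ring.
by rewrite sumrN telescope_sumr // opprB.
Qed.

Lemma dominant_weight_of_gaps x : dominant_weights R r x ->
  exists d : nat -> nat, x = weight_of_gaps (fun t => (d t)%:R).
Proof.
(* Tail sums of [c] have the [c t] as successive differences. *)
move=> [c ->]; exists (fun t => \sum_(t <= k < r) c k)%N.
apply: eq_big_nat => t /andP[_ tr]; congr (_ *: _).
by rewrite [in RHS]big_ltn // natrD addrK.
Qed.

Lemma Omega_dominant (lam : r.-tuple nat) : is_partition lam ->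
  dominant_weights R r (Omega R lam).
Proof.
move=> lamP; exists (fun t => beta lam t - beta lam t.+1)%N.
apply: eq_big_nat => -[//|t] /andP[_ tr]; congr (_ *: _).
rewrite natrB //; apply: ltnW.
exact: (@beta_decreasing _ lam (Ordinal (ltnW tr)) (Ordinal tr)).
Qed.

(** On [Espace], summing [x 0 i - x 0 j] over [j] gives [r] times [x 0 i]. *)
Lemma Espace_eq x y : (forall i j, x 0 i - x 0 j = y 0 i - y 0 j) ->
  Espace x -> Espace y -> x = y.
Proof.
move=> xy x0 y0; apply/rowP => i.
have : \sum_(j < r) (x 0 i - x 0 j) = \sum_(j < r) (y 0 i - y 0 j).
  exact: eq_bigr.
rewrite !sumrB x0 y0 !subr0 !sumr_const card_ord => /eqP.
by rewrite -subr_eq0 -mulrnBl mulrn_eq0 => /orP[/eqP r0|];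
  [have := ltn_ord i; rewrite {2}r0 | rewrite subr_eq0 => /eqP].
Qed.

(** * Alcoves as intersections of strips, one for each positive root *)

Section Alcoves.
Context {e : nat} (e_gt0 : (0 < e)%N).
Implicit Types k : 'I_r -> 'I_r -> int.

Definition gap_region k : set 'rV[R]_r :=
  [set x | Espace x /\ forall i j : 'I_r, (i < j)%N ->
     (k i j)%:~R * e%:R < pairing (root_vec R i j) x < (k i j + 1)%:~R * e%:R].

Lemma gap_region_hyperplane_complement k :
  gap_region k `<=` hyperplane_complement e.
Proof.
move=> x [xE xk]; split=> // i j m ij; rewrite /hyperplane /= => xm.
have := xk _ _ ij; rewrite xm !ltr_pM2r ?ltr0n // !ltr_int; lia.
Qed.

Lemma gap_region_connected k : connected (gap_region k).
Proof.
have [[a [aE ak]]|] := pselect (gap_region k !=set0); last first.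
  by move=> /set0P/negP/negPn/eqP ->; exact: connected0.
pose seg (y : 'rV[R]_r) := (fun c : R => a + c *: (y - a)) @` `[0, 1].
(* The region is the union of the segments from [a] to its points, all sharing [a]. *)
have -> : gap_region k = \bigcup_(y in gap_region k) seg y.
  apply/seteqP; split=> [y yk|_ [y [yE yk] [c /= + <-]]].
    exists y => //; exists 1; rewrite /= ?in_itv /= ?lexx ?ler01 //.
    by rewrite scale1r subrKC.
  rewrite in_itv /= => /andP[c0 c1]; split.
    rewrite /Espace /=.
    under eq_bigr do rewrite !mxE mulrBr.
    by rewrite big_split /= sumrB -!mulr_sumr yE aE; ring.
  move=> i j ij; move: (ak i j ij) (yk i j ij); rewrite !pairing_root !mxE.
  set l := _%:~R * _; set u := _%:~R * _ => /andP[la ua] /andP[ly uy].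
  rewrite (_ : _ - _ = c * (y 0 i - y 0 j) + (1 - c) * (a 0 i - a 0 j));
    last by ring.
  by apply/andP; split; [exact: convex_comb_gt | exact: convex_comb_lt].
apply: bigcup_connected => [|y _].
  exists a => y _; exists 0; rewrite /= ?in_itv /= ?lexx ?ler01 //.
  by rewrite scale0r addr0.
apply: connected_continuous_connected; first exact: segment_connected.
apply: continuous_subspaceT => c.
apply: cvgD; first exact: cvg_cst.
exact: scalel_continuous.
Qed.

Lemma gap_region_alcove k x : gap_region k x -> is_alcove e (gap_region k).
Proof.
move=> xk; exists x; first exact: gap_region_hyperplane_complement xk.
apply/seteqP; split.
  apply: connected_component_max => //.
    exact: gap_region_hyperplane_complement.
  exact: gap_region_connected.
move=> y [B [Bx Bc Bconn] By]; split=> [|i j ij]; first by have [] := Bc _ By.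
have [_ xij] := xk; have {xij} := xij i j ij.
have proj_cont : continuous (pairing (root_vec R i j)).
  rewrite (_ : pairing _ = fun x => x 0 i - x 0 j); last first.
    by apply/funext => z; rewrite pairing_root.
  move=> z; have coord l := @coord_continuous R 1 r 0 l z.
  exact: (cvgB (coord i) (coord j)).
have /connected_intervalP itvB :
    connected (pairing (root_vec R i j) @` B).
  apply: connected_continuous_connected => //.
  exact: continuous_subspaceT.
have avoid (m : int) : ~ (pairing (root_vec R i j) @` B) (m%:~R * e%:R).
  by move=> [z Bz zm]; have [_ /(_ i j m ij)] := Bc _ Bz; exact.
have xB : (pairing (root_vec R i j) @` B) (pairing (root_vec R i j) x).
  by exists x.
have yB : (pairing (root_vec R i j) @` B) (pairing (root_vec R i j) y).
  by exists y.
(* If [y] left the strip of this root, the interval of values on [B] would contain the endpoint of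
   the strip lying between the values at [x] and [y]. *)
move=> /andP[lx ux]; rewrite !ltNge -negb_or; apply/negP => /orP[yl|uy].
- by apply: (avoid (k i j)); apply: (itvB _ _ yB xB); rewrite yl ltW.
- by apply: (avoid (k i j + 1)); apply: (itvB _ _ xB yB); rewrite uy ltW.
Qed.

End Alcoves.
End Weights.

(** * The copy as the set of dominant weights in one region *)

Section CopyAlcove.
Context {R : realType} {r e : nat} {mu : r.-tuple nat} {p : {perm 'I_r}}.
Context (r_lt_e : (r < e)%N).
Context (p_sorts : forall t u : 'I_r,
  (p t < p u)%N = (tnth mu u * e + u < tnth mu t * e + t)%N).

(* If [t < u], bead [t] lies on the smaller runner, so when it is the larger
   bead the difference of the two falls short of [(mu_t - mu_u) e]. *)
Definition copy_gap (i j : 'I_r) : int :=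
  (tnth mu (p^-1%g i))%:Z - (tnth mu (p^-1%g j))%:Z
  - (p^-1%g i < p^-1%g j)%N%:Z.

Lemma sorted_lex t u : (p t < p u)%N =
  ((tnth mu u < tnth mu t) || (tnth mu u == tnth mu t) && (u < t))%N.
Proof. by rewrite p_sorts ltn_mulD_lex //; exact: ltn_trans r_lt_e. Qed.

(** For [i < j], a strict drop in rows absorbs the subtracted indicator; in a tie the first bead has
    the larger runner and the indicator vanishes. *)
Lemma copy_gap_ge0 (i j : 'I_r) : (i < j)%N -> 0 <= copy_gap i j.
Proof.
rewrite -{1}(permKV p i) -{1}(permKV p j) sorted_lex /copy_gap; lia.
Qed.

Lemma copy_gap_regionP (x : 'rV[R]_r) : gap_region (e := e) copy_gap x <->
  Espace x /\ forall t u : 'I_r, (t < u)%N ->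
    0 < (x 0 (p u) - (tnth mu u)%:R * e%:R)
        - (x 0 (p t) - (tnth mu t)%:R * e%:R) < e%:R.
Proof.
rewrite /gap_region /=; split=> -[xE xg]; split=> //.
- move=> t u tu; case: (ltngtP (p t) (p u)) => [ptu|put|/val_inj/perm_inj tu0].
  + have := xg _ _ ptu; rewrite pairing_root /copy_gap !permK tu.
    by rewrite !(rmorphB, rmorphD) /= => /andP[? ?]; apply/andP; split; lra.
  + have := xg _ _ put; rewrite pairing_root /copy_gap !permK ltnNge (ltnW tu).
    by rewrite !(rmorphB, rmorphD) /= => /andP[? ?]; apply/andP; split; lra.
  + by rewrite tu0 ltnn in tu.
- move=> i j ij; rewrite pairing_root /copy_gap.
  have := xg (p^-1%g i) (p^-1%g j); have := xg (p^-1%g j) (p^-1%g i).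
  rewrite !permKV; case: ltngtP => [_ + _|_ _ +|/val_inj/perm_inj ij0].
  + by move=> /(_ isT) /andP[? ?]; rewrite !(rmorphB, rmorphD) /=;
      apply/andP; split; lra.
  + by move=> /(_ isT) /andP[? ?]; rewrite !(rmorphB, rmorphD) /=;
      apply/andP; split; lra.
  + by rewrite ij0 ltnn in ij.
Qed.

(** Since [s] is increasing, the positions of the beads follow the same lexicographic order as [p],
    whatever the runners are. *)
Lemma beta_sorting_perm (lam : r.-tuple nat) (s : 'I_r -> 'I_e) :
  is_partition lam -> (forall t u : 'I_r, (t < u)%N -> (s t < s u)%N) ->
  (forall t : 'I_r, bead lam (tnth mu t) (s t)) ->
  forall t, beta lam (p t).+1 = (tnth mu t * e + s t)%N.
Proof.
move=> lamP sI lam_bead.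
have /fin_all_exists[f fE] t :
    exists i : 'I_r, beta lam i.+1 = (tnth mu t * e + s t)%N.
  by have /existsP[i /eqP] := lam_bead t; exists i.
have s_lt := ord_homo_mono _ _ sI.
have f_lt t u : (f t < f u)%N = (p t < p u)%N.
  transitivity (beta lam (f u).+1 < beta lam (f t).+1)%N.
    have beta_lt i j := @beta_decreasing _ lam i j lamP.
    case: (ltngtP (f t) (f u)) => [/beta_lt//|/beta_lt/ltnW|->].
      by rewrite leqNgt => /negPf.
    by rewrite ltnn.
  by rewrite !fE ltn_mulD_lex // s_lt sorted_lex.
have fI : injective f.
  move=> t u ftu; apply: (@perm_inj _ p); apply: val_inj.
  by case: (ltngtP (p t) (p u)); rewrite // -f_lt ftu ltnn.
by move=> t; rewrite -fE -(ord_inj_lt_unique _ _ _ fI (@perm_inj _ p) f_lt).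
Qed.

Lemma copy_eq_gap_region : (0 < r)%N ->
  copy R e mu = gap_region (e := e) copy_gap `&` dominant_weights R r.
Proof.
move=> r_gt0; apply/seteqP; split=> [_ [lam [s [lamP sI lam_bead ->]]]|x].
  have betaE := beta_sorting_perm _ _ lamP sI (fun t => (lam_bead t _).2 erefl).
  split.
    apply/copy_gap_regionP; split; first exact: Espace_weight_of_gaps.
    move=> t u tu; have := sI _ _ tu; have := ltn_ord (s u).
    have := @weight_of_gapsB R r (fun t => (beta lam t)%:R) (p u) (p t).
    rewrite !betaE !natrD !natrM -(ltr_nat R) -(ltr_nat R (s t)).
    have := ler0n R (s t); rewrite /Omega /weight_of_gaps /=.
    by move=> ? ? ? ?; apply/andP; split; lra.
  apply: Omega_dominant lamP.
move=> [/copy_gap_regionP[xE xg]] /dominant_weight_of_gaps[d xd].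
(* Removing the row contribution leaves the runner of the bead, up to a constant common to all
   beads. *)
pose y (t : 'I_r) : int := (d (p t).+1)%:Z - (tnth mu t)%:Z * e%:Z.
have yg (t u : 'I_r) : (t < u)%N -> 0 < y u - y t < e%:Z.
  move=> /xg; have := weight_of_gapsB (fun t => (d t)%:R : R) (p u) (p t).
  rewrite -xd -!(ltr_int R) /y !(rmorphB, rmorphM) /= => xB /andP[? ?].
  by apply/andP; split; lra.
pose t0 := Ordinal r_gt0.
have /fin_all_exists[s sE] t : exists z : 'I_e, y t = y t0 + z%:Z.
  have [t_gt0|t_le0] := ltnP t0 t; last first.
    exists (Ordinal (ltn_trans r_gt0 r_lt_e)); rewrite addr0; congr y.
    by apply: val_inj; rewrite /=; move: t_le0 => /=; lia.
  have yt := yg _ _ t_gt0.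
  have lt_e : (`|y t - y t0| < e)%N by lia.
  by exists (Ordinal lt_e) => /=; lia.
have sI (t u : 'I_r) : (t < u)%N -> (s t < s u)%N.
  by move=> /yg; rewrite (sE t) (sE u); lia.
pose b i := (tnth mu (p^-1%g i) * e + s (p^-1%g i))%N.
(* The rebuilt beads differ from [d] by the constant [y t0] alone, so they define the same
   weight. *)
have bE i : (b i)%:Z = (d i.+1)%:Z - y t0.
  have := sE (p^-1%g i); rewrite /b /y permKV; lia.
have bp t : b (p t) = (tnth mu t * e + s t)%N by rewrite /b permK.
have s_lt := ord_homo_mono _ _ sI.
have b_lt (i j : 'I_r) : (i < j)%N -> (b j < b i)%N.
  by rewrite -{1}(permKV p i) -{1}(permKV p j) sorted_lex /b
             ltn_mulD_lex // s_lt.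
have [lam lamP lamE] := partition_of_beta b b_lt.
exists lam, s; split=> // [t a|].
  split=> [/existsP[i]|->]; last first.
    by apply/existsP; exists (p t); rewrite lamE bp.
  rewrite lamE -(permKV p i) bp => /eqP ba.
  have e_gt0 : (0 < e)%N by exact: leq_ltn_trans r_lt_e.
  (* The residue modulo [e] is the runner, and distinct beads have distinct runners. *)
  have := congr1 (modn^~ e) ba; rewrite !modnMDl !modn_small // => /val_inj st.
  have tE : p^-1%g i = t.
    apply: val_inj; have := s_lt (p^-1%g i) t; have := s_lt t (p^-1%g i).
    by rewrite st ltnn; case: ltngtP.
  by move: ba; rewrite tE => /addIn/eqP; rewrite eqn_pmul2r // => /eqP.
apply: Espace_eq => //; last exact: Espace_weight_of_gaps.
move=> i j; rewrite xd (weight_of_gapsB (fun t => (d t)%:R)).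
rewrite (weight_of_gapsB (fun t => (beta lam t)%:R)) !lamE.
have natE (n : nat) : n%:R = n%:Z%:~R :> R by [].
by rewrite !natE !bE !rmorphB /=; ring.
Qed.

End CopyAlcove.

Theorem lemma3p51 (R : realType) (r e w : nat) (hr : (3 <= r)%N)
    (he : (r < e)%N) (mu : r.-tuple nat) (hmu : weak_composition w mu) :
  exists A : set 'rV[R]_r,
    is_dominant_alcove e A /\ copy R e mu = A `&` dominant_weights R r.
Proof.
have r_gt0 : (0 < r)%N by exact: leq_trans hr.
have e_gt0 : (0 < e)%N by exact: leq_ltn_trans he.
(* The configuration with [s t = t], available since [r < e], supplies both the sorting order and a
   point of the region. *)
pose b (t : 'I_r) := (tnth mu t * e + t)%N.
have b_inj : injective b.
  move=> t u /(congr1 (modn^~ e)); rewrite !modnMDl.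
  by rewrite !modn_small ?(ltn_trans _ he) // => /val_inj.
have [p p_sorts] := exists_sorting_perm _ _ b_inj.
exists (gap_region (e := e) (copy_gap (mu := mu) (p := p))); split; last first.
  exact: copy_eq_gap_region.
split; last first.
  move=> x [xE xg]; split=> // i j ji; have ij : (i < j)%N by rewrite ji.
  have /andP[/ltW + _] := xg i j ij; apply: le_trans.
  by rewrite mulr_ge0 // ler0z (copy_gap_ge0 he p_sorts).
(* Only indices from 1 to [r] enter the weight, so the default 0 is never reached. *)
pose x0 := weight_of_gaps (r := r) (fun t : nat =>
  if insub t.-1 is Some i then (b (p^-1%g i))%:R : R else 0).
apply: (@gap_region_alcove _ _ _ e_gt0 _ x0).
apply/copy_gap_regionP; split=> [|t u tu].
  exact: Espace_weight_of_gaps.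
have := weight_of_gapsB (fun t : nat =>
  if insub t.-1 is Some i then (b (p^-1%g i))%:R : R else 0) (p u) (p t).
rewrite /= !valK !permK -/x0 /b !natrD !natrM => x0B.
have : (t%:R : R) < u%:R by rewrite ltr_nat.
have : (u%:R : R) < e%:R by rewrite ltr_nat (ltn_trans _ he).
have := ler0n R t.
by move=> ? ? ?; apply/andP; split; lra.
Qed.
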